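(* Let $p$ be a prime and let $G$ be a finite powerful $p$-group. Then, for every integer $i\ge 0$: (i) If $x,y\in G$ and $o(y)\le p^i$, then $o([x,y])\le p^i$. (ii) If $x,y\in G$ are such that $o(x)\le p^{i+1}$ and $o(y)\le p^i$, then $o([x^{p^j},y^{p^k}])\le p^{i-j-k}$ for all integers $j,k\ge 0$, where, if $i-j-k<0$, this inequality means by convention that $[x^{p^j},y^{p^k}]=1$. (iii) If $p$ is odd, then $\exp\Omega_i(G)\le p^i$. (iv) If $p=2$, then $\exp\Omega_i(T)\le 2^i$ for any subgroup $T$ of $G$ which is cyclic over $G^2$. In particular, $\exp\Omega_i(G^2)\le 2^i$.
   Context: For a group $G$ and $n\ge 1$, $G^n$ denotes the subgroup generated by all $n$-th powers of elements of $G$, and $G'=[G,G]$. A finite $p$-group $G$ is powerful if $G'\le G^p$ when $p$ is odd, and $G'\le G^4$ when $p=2$. Commutators are $[x,y]=x^{-1}y^{-1}xy$; $o(x)$ denotes the order of $x$, and $\exp$ the exponent of a finite group. For a finite $p$-group $P$ and $i\ge 0$, $\Omega_i(P)$ is the subgroup of $P$ generated by all elements of $P$ of order at most $p^i$. Convention: for $m<0$, the inequality $o(x)\le p^m$ is defined to mean $x=1$. A subgroup $T$ of $G$ is cyclic over $G^2$ if $TG^2/G^2$ is cyclic, i.e. $T\le\langle t,G^2\rangle$ for some $t\in T$ (it is not required that $T$ contain $G^2$). *)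

(* Defs.v *)
From mathcomp Require Import all_boot all_order all_algebra all_fingroup all_solvable.

Set Implicit Arguments.
Unset Strict Implicit.
Unset Printing Implicit Defensive.

Import GroupScope.

Section Definitions.

Variable gT : finGroupType.
Implicit Types (p n : nat) (x : gT) (A : {set gT}) (G P T : {group gT}).

Definition power_subgroup A n : {set gT} := <<[set x ^+ n | x in A]>>.

Canonical power_subgroup_group A n := [group of power_subgroup A n].

Definition powerful p A : bool :=
  A^`(1) \subset power_subgroup A (if p == 2 then 4 else p).

(* The inequality o(x) <= p ^ m for a possibly negative integer m: when m < 0 it
   means x = 1 by convention. *)
Definition order_le p x (m : int) : Prop :=
  match m with
  | Posz n => (#[x] <= p ^ n)%N
  | Negz _ => x = 1
  end.

Definition cyclic_over_squares G T : bool :=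
  cyclic ((T * power_subgroup G 2) / power_subgroup G 2).

Lemma power_subgroup_sub G n : power_subgroup G n \subset G.
Proof. by rewrite gen_subG; apply/subsetP=> _ /imsetP[x Gx ->]; exact: groupX. Qed.

Lemma power_subgroup_normal G n : power_subgroup G n <| G.
Proof.
rewrite /normal power_subgroup_sub; apply/subsetP=> g Gg.
rewrite inE -genJ genS //; apply/subsetP=> _ /imsetP[_ /imsetP[x Gx ->] ->].
by rewrite conjXg; apply: imset_f; rewrite groupJ.
Qed.

Lemma cyclic_over_squaresP G T : T \subset G ->
  reflect (exists2 t, t \in T & T \subset <<t |: power_subgroup G 2>>)
          (cyclic_over_squares G T).
Proof.
move=> sTG; have nNG := normal_norm (power_subgroup_normal G 2).
have nNT := subset_trans sTG nNG.
rewrite /cyclic_over_squares quotientMidr.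
have genE t : t \in T ->
  (T \subset <<t |: power_subgroup G 2>>)
    = (T / power_subgroup G 2 \subset <[coset (power_subgroup G 2) t]>).
  move=> Tt; have Nt := subsetP nNT _ Tt.
  rewrite -quotient_cycle // quotientSK // -norm_joinEr ?cycle_subG //.
  by rewrite joing_idr setUC.
apply: (iffP cyclicP) => [[c defT] | [t Tt sT]].
  have /morphimP[t Nt Tt def_c]: c \in T / power_subgroup G 2 by rewrite defT cycle_id.
  by exists t => //; rewrite genE // -def_c defT.
exists (coset (power_subgroup G 2) t); apply/eqP.
by rewrite eqEsubset -genE // sT cycle_subG mem_quotient.
Qed.

(* The library defines 'Ohm_i through the smallest prime divisor of each
   element's order; for a p-group this is the usual description. *)
Lemma Ohm_gen_order_le p P i : prime p -> p.-group P ->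
  'Ohm_i(P) = <<[set x in P | #[x] <= p ^ i]>>.
Proof.
move=> p_pr pP; rewrite (OhmE i pP); congr <<_>>; apply/setP=> x.
rewrite !inE; case Px: (x \in P) => //=.
have /p_natP[k ox] : p.-nat #[x] := mem_p_elt pP Px.
by rewrite -order_dvdn ox dvdn_Pexp2l ?leq_exp2l ?prime_gt1.
Qed.

End Definitions.

(* Main.v *)
Require Import Defs.
From mathcomp Require Import all_boot all_order all_algebra all_fingroup all_solvable.
From mathcomp Require Import zify.

Set Implicit Arguments.
Unset Strict Implicit.
Unset Printing Implicit Defensive.

Import GroupScope.

(** Write M^n for 'Mho^n(G), the subgroup generated by the p^n-th powers, and e
    for 1 if p is odd and 2 if p = 2, so that powerful means [G, G] <= M^e.

    The structural input is the classical Lubotzky-Mann theory, built first: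
    powerful embedding passes from N to 'Mho^1(N) (powerfully_embedded_Mho1),
    the subgroup generated by y and M^1 is again powerful
    (powerfully_embedded_slice), every element of M^n is the p^n-th power of a
    single element (Mho_root), and [M^n, G] <= M^(n + e) (comm_Mho).

    The four claims are then proved by one induction on |G|, the induction
    hypothesis being the bound on the exponents of the Omega subgroups.

    (i) If G is not cyclic, y and its conjugate y^x lie in the subgroup generated
    by y and M^e, to which the induction hypothesis applies inside the proper
    powerful subgroup generated by y and M^1.  Hence [x, y], a quotient of two
    elements of order at most p^i, has order at most p^i.

    (ii) This goes by downward induction on i, the statement being trivial once
    p^i is at least |G|^3; then by induction on j.  Put x' = x^(p^j),
    c = [x', y^(p^k)] and l = i - (j + 1) - k.  It suffices that the p-th powers
    of x' and of its conjugate x' c agree modulo N = 'Ohm_l(M^e), a subgroup whose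
    exponent is controlled by the induction hypothesis.  The commutator
    a = [c, x'] is the p^(k + 2)-th power of some u, and statement (ii) for i + 1
    and u shows that a commutes modulo N with x' and with its conjugate x' c,
    hence with c.  The class 2 formula for (x' c)^p then concludes.  Passing from
    i to i + 1 is what makes room for roots: an element of order at most p^m in
    M^n has p^n-th roots of order at most p^(m + n).

    (iii), (iv) Applied to roots, (ii) makes the elements of order p commute
    enough for their products to have order p when p is odd.  When p = 2, the one
    case left is that of two involutions outside M^1, whose product is inverted by
    each of them; inverted_sqr_eq1 treats it.  Hence 'Ohm_1 has exponent p, and one
    factors it out to reach 'Ohm_i. *)

(** * Powerful embedding *)

Definition eps (p : nat) : nat := if p == 2 then 2 else 1%N.

Definition powerfully_embedded (p : nat) (gT : finGroupType) (N G : {set gT}) :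
  bool :=
  [~: N, G] \subset 'Mho^(eps p)(N).

Lemma eps_gt0 p : 0 < eps p. Proof. by rewrite /eps; case: eqP. Qed.
Lemma eps_le2 p : eps p <= 2. Proof. by rewrite /eps; case: eqP. Qed.

Section ClassTwoPowers.

Variables (gT : finGroupType) (p : nat).
Hypothesis p_pr : prime p.
Implicit Types x y z : gT.

(** The exponent p ^ (2 - eps p) is p for odd p, which divides 'C(p, 2), and 1
    for p = 2, where 'C(2, 2) = 1: this covers both parities at once. *)
Lemma expg_bin2_eq1 z : z ^+ (p ^ (2 - eps p)) = 1 -> z ^+ 'C(p, 2) = 1.
Proof.
rewrite /eps; case: eqP => [-> | /eqP p_neq2]; first by rewrite binn.
rewrite subSS subn0 expn1 => zp1; have p_gt2: 2 < p.
  by rewrite ltn_neqAle eq_sym p_neq2 prime_gt1.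
have /dvdnP[m ->]: p %| 'C(p, 2) by rewrite prime_dvd_bin.
by rewrite mulnC expgM zp1 expg1n.
Qed.

Lemma expgM_p x y :
    commute x [~ x, y] -> commute y [~ x, y] ->
    [~ x, y] ^+ (p ^ (2 - eps p)) = 1 ->
  (y * x) ^+ p = y ^+ p * x ^+ p.
Proof.
by move=> cx cy /expg_bin2_eq1 z1; rewrite expMg_Rmul // z1 mulg1.
Qed.

End ClassTwoPowers.

Section Powers.

Variables (gT : finGroupType) (p : nat) (G : {group gT}).
Hypothesis pG : p.-group G.

Lemma Mho_expg n x : x \in G -> x ^+ (p ^ n) \in 'Mho^n(G).
Proof. by move=> Gx; rewrite Mho_p_elt ?(mem_p_elt pG). Qed.

Lemma sub_Mho n (A : {group gT}) :
  (forall x, x \in G -> x ^+ (p ^ n) \in A) -> 'Mho^n(G) \subset A.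
Proof.
move=> sA; rewrite (MhoE n pG) gen_subG; apply/subsetP=> _ /imsetP[x Gx ->].
exact: sA.
Qed.

Lemma pgroup_Mho n : p.-group 'Mho^n(G). Proof. exact: pgroupS (Mho_sub _ _) pG. Qed.

End Powers.

(** For an arbitrary p-group this inclusion may be strict; equality is one of the
    gains of powerfulness, see Mho_chain. *)
Lemma MhoD_sub (gT : finGroupType) (p : nat) (G : {group gT}) m n : p.-group G ->
  'Mho^(m + n)(G) \subset 'Mho^n('Mho^m(G)).
Proof.
move=> pG; apply: (sub_Mho pG) => x Gx.
by rewrite expnD expgM Mho_expg ?pgroup_Mho // (Mho_expg pG).
Qed.

Lemma central_commXg (gT : finGroupType) (x y : gT) n (H : {group gT}) :
  [~ x, y] \in 'C(H) -> x \in H -> [~ x ^+ n, y] = [~ x, y] ^+ n.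
Proof. by move=> /centP cH Hx; apply: commXg; apply: commute_sym; apply: cH. Qed.

Lemma quotient_Mho (gT : finGroupType) n (N K : {group gT}) :
  N \subset 'N(K) -> 'Mho^n(N) / K = 'Mho^n(N / K).
Proof. by move=> nKN; apply: morphim_Mho. Qed.

Lemma quotient_powerfully_embedded p (gT : finGroupType) (N G K : {group gT}) :
  N \subset 'N(K) -> G \subset 'N(K) ->
  powerfully_embedded p N G -> powerfully_embedded p (N / K) (G / K).
Proof.
by move=> nKN nKG peN; rewrite /powerfully_embedded -quotientR // -quotient_Mho
  ?quotientS.
Qed.

Section CentralCommutators.

Variables (gT : finGroupType) (p : nat) (N G : {group gT}).
Hypotheses (p_pr : prime p) (pG : p.-group G) (nNG : N <| G).
Hypothesis peN : powerfully_embedded p N G.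
Hypothesis M_eps1 : 'Mho^(eps p)('Mho^1(N)) = 1.
Hypothesis cRG : [~: 'Mho^1(N), G] \subset 'C(G).

Let sNG : N \subset G. Proof. exact: normal_sub. Qed.
Let pN : p.-group N. Proof. exact: pgroupS sNG pG. Qed.
Let M := 'Mho^1(N).
Let sMN : M \subset N. Proof. exact: Mho_sub. Qed.
Let pM : p.-group M. Proof. exact: pgroup_Mho. Qed.

Let M_exp m : m \in M -> m ^+ (p ^ eps p) = 1.
Proof. by move/(Mho_expg pM (eps p)); rewrite M_eps1 => /set1P. Qed.

Let cR m g n : m \in M -> g \in G -> [~ m ^+ n, g] = [~ m, g] ^+ n.
Proof.
move=> Mm Gg; apply: (central_commXg _ (H := G)).
  by apply: subsetP cRG _ _; apply: mem_commg.
exact: subsetP sNG _ (subsetP sMN _ Mm).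
Qed.

Let cR2 m m' n : m \in M -> m' \in M -> [~ m, m' ^+ n] = [~ m, m'] ^+ n.
Proof.
move=> Mm Mm'; have sMG := subset_trans sMN sNG.
by rewrite -invg_comm cR // ?(subsetP sMG) // -expgVn invg_comm.
Qed.

Let Mho_eps_prop d : d \in 'Mho^(eps p)(N) ->
  d ^+ p = 1 /\ forall g, g \in G -> [~ d, g] ^+ (p ^ (2 - eps p)) = 1.
Proof.
have sMG := subset_trans sMN sNG.
rewrite /eps; have [p2 | p_neq2] := eqVneq p 2; last first.
  rewrite subSS subn0 => Md; have dp1: d ^+ p = 1.
    by have:= M_exp Md; rewrite /eps (negPf p_neq2).
  by split=> // g Gg; rewrite expn1 -cR // dp1 comm1g.
(* For p = 2 everything takes place in the group generated by the squares of M: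
   these commute with each other since [a^2, b^2] = [a, b^4] = 1. *)
pose S := [set m ^+ 2 | m in M]; have sS: 'Mho^2(N) \subset <<S>>.
  apply: (sub_Mho pN) => x Nx; rewrite mem_gen // p2 (expgM x 2 2).
  by apply: imset_f; move: (Mho_expg pN 1 Nx); rewrite p2.
have m4 m : m \in M -> m ^+ 4 = 1.
  by move/M_exp; rewrite /eps p2.
have cS: abelian S.
  apply/centsP=> _ /imsetP[a Ma ->] _ /imsetP[b Mb ->].
  apply/commgP; rewrite cR ?groupX ?(subsetP sMG) // cR2 // -expgM.
  by rewrite -cR2 // m4 // commg1.
have eS d' : d' \in 'Mho^2(N) -> d' ^+ 2 = 1.
  move=> /(subsetP sS); apply/exponentP: d'; rewrite abelian_exponent_gen //.
  by apply/exponentP=> _ /imsetP[a Ma ->]; rewrite -expgM m4.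
have cSG: 'Mho^2(N) \subset 'C(G).
  apply: subset_trans sS _; rewrite gen_subG; apply/subsetP=> _ /imsetP[a Ma ->].
  apply/centP=> g Gg; apply/commgP; rewrite cR // eS //.
  move: peN; rewrite /powerfully_embedded /eps p2 => /subsetP; apply.
  by rewrite mem_commg // (subsetP sMN).
move=> Md; rewrite p2 eS //; split=> // g Gg.
by apply/eqP; apply/commgP; apply: (centP (subsetP cSG _ Md)).
Qed.

(** With d = [x, g], class 2 collection gives (x^p)^g = (x d)^p = x^p d^p, and
    d^p = 1 because d lies in 'Mho^(eps p)(N). *)
Lemma Mho1_central_core : M \subset 'C(G).
Proof.
have sMG := subset_trans sMN sNG.
apply: (sub_Mho pN) => x Nx; rewrite expn1; apply/centP=> g Gg; apply/commgP.
have Gx := subsetP sNG _ Nx; set d := [~ x, g].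
have Md: d \in 'Mho^(eps p)(N) by apply: subsetP peN _ _; apply: mem_commg.
have [dp1 dR] := Mho_eps_prop Md.
have MMd: d \in M by apply: subsetP Md; apply/Mho_leq/eps_gt0.
have cd h : h \in G -> commute h [~ d, x].
  move=> Gh; apply: commute_sym; apply: (centP (subsetP cRG _ _)) => //.
  exact: mem_commg.
have: (x ^ g) ^+ p = x ^+ p * d ^+ p.
  by rewrite conjg_mulR (expgM_p p_pr (cd _ _) (cd _ Gx) (dR _ Gx)) ?(subsetP sMG).
by rewrite dp1 mulg1 -conjXg => xg; rewrite commgEl xg mulVg.
Qed.

End CentralCommutators.

(** Let X = [M, G] with M = 'Mho^1(N), and Y = 'Mho^(eps p)(M).  As G is
    nilpotent, X <= Y [X, G] is enough for X <= Y; so one may factor out Y [X, G],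
    which makes Y trivial and X central, the situation of Mho1_central_core. *)
Lemma powerfully_embedded_Mho1 (gT : finGroupType) (p : nat) (N G : {group gT}) :
  prime p -> p.-group G -> N <| G -> powerfully_embedded p N G ->
  powerfully_embedded p 'Mho^1(N) G.
Proof.
move=> p_pr pG nNG peN; have sNG := normal_sub nNG.
pose M := 'Mho^1(N)%G; pose X := [~: M, G]%G; pose Y := 'Mho^(eps p)(M)%G.
have nMG: M <| G := gFnormal_trans _ nNG.
have nYG: Y <| G := gFnormal_trans _ nMG.
have sXG: X \subset G.
  by rewrite comm_subG // normal_sub.
have nXG: G \subset 'N(X) by apply: commg_normr.
pose K := (Y <*> [~: X, G])%G.
have nKG : G \subset 'N(K) by rewrite normsY ?(normal_norm nYG) ?commg_normr.
have nKN := subset_trans sNG nKG.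
have nKM := subset_trans (normal_sub nMG) nKG.
have cM: 'Mho^1(N / K) \subset 'C(G / K).
  apply: (@Mho1_central_core _ p (N / K)%G (G / K)%G) => //.
  - exact: quotient_pgroup.
  - exact: quotient_normal.
  - exact: quotient_powerfully_embedded.
  - rewrite /= -quotient_Mho // -quotient_Mho //; apply/trivgP.
    by rewrite quotient_sub1 ?joing_subl // (subset_trans (Mho_sub _ _)).
  rewrite /= -quotient_Mho // -quotientR // quotient_cents2 ?joing_subr //.
  exact: subset_trans sXG nKG.
have sXK: X \subset K.
  by rewrite -quotient_cents2 // quotient_Mho.
rewrite /powerfully_embedded -[[~: _, _]]/(gval X) -[Mho _ _]/(gval Y).
apply: contraLR sXK => nsXY.
have nYX: X \subset 'N(Y) := subset_trans sXG (normal_norm nYG).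
have nYR: [~: X, G] \subset 'N(Y) by rewrite (subset_trans _ (normal_norm nYG)) // comm_subG.
have ->: (X \subset K) = (X / Y \subset [~: X / Y, G / Y]).
  rewrite -(quotientR nYX (normal_norm nYG)) quotientSK // /K /= norm_joinEr //.
have: [~: X / Y, G / Y] \proper (X / Y).
  apply: (@nil_comm_properl _ (G / Y)).
  - exact: pgroup_nil (quotient_pgroup _ pG).
  - exact: quotientS.
  - by rewrite -subG1 quotient_sub1.
  by rewrite subsetI subxx quotient_norms.
by rewrite properE => /andP[_].
Qed.

(** * Powerful p-groups: slices and roots *)

Section Powerful.

Variables (gT : finGroupType) (p : nat).
Hypothesis p_pr : prime p.
Implicit Types G H N : {group gT}.

Lemma powerful_embedded_self G : p.-group G -> powerful p G -> powerfully_embedded p G G.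
Proof.
move=> pG; rewrite /powerful /powerfully_embedded derg1 /power_subgroup (MhoE _ pG) /eps.
by case: eqP => // ->.
Qed.

(** When G is powerful and not cyclic, slices are proper powerful subgroups, and
    inductions on |G| pass to the slice through a prescribed element. *)
Definition slice (y : gT) G : {group gT} := (<[y]> <*> 'Mho^1(G))%G.

Lemma slice_sub y G : y \in G -> slice y G \subset G.
Proof. by move=> Gy; rewrite join_subG cycle_subG Gy Mho_sub. Qed.

Lemma mem_slice y G : y \in slice y G.
Proof. by apply: subsetP (cycle_id y); apply: joing_subl. Qed.

Lemma Mho1_sub_slice y G : 'Mho^1(G) \subset slice y G.
Proof. exact: joing_subr. Qed.

(** Modulo [M, G], where M = 'Mho^1(G), a slice is generated by y and a central
    subgroup, hence is abelian; so its derived group lies in [M, G], which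
    powerfully_embedded_Mho1 puts in 'Mho^(eps p)(M). *)
Lemma powerfully_embedded_slice y G :
  p.-group G -> powerfully_embedded p G G -> y \in G ->
  powerfully_embedded p (slice y G) (slice y G).
Proof.
move=> pG peG Gy; set H := slice y G; pose M := 'Mho^1(G)%G.
have sHG : H \subset G by apply: slice_sub.
have peM : powerfully_embedded p M G by apply: powerfully_embedded_Mho1.
have sMH : M \subset H by apply: Mho1_sub_slice.
pose R := [~: M, G]%G; have nRG : G \subset 'N(R) by apply: commg_normr.
have cMG : M / R \subset 'C(G / R) by apply: quotient_cents2r.
have sMG : M \subset G by apply: Mho_sub.
apply: (subset_trans (B := R)).
  rewrite -derg1 der1_min ?(subset_trans sHG) //.
  rewrite /H /= quotientY ?(subset_trans _ nRG) ?cycle_subG // abelianY.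
  rewrite quotient_abelian ?cycle_abelian //=.
  rewrite /abelian !(subset_trans cMG) ?centS ?quotientS ?cycle_subG //.
exact: subset_trans peM (MhoS _ sMH).
Qed.

(** A powerful p-group has 'Mho^1(G) as its Frattini subgroup, so a slice that
    exhausts G forces G to be generated by one element. *)
Lemma slice_proper y G :
  p.-group G -> powerfully_embedded p G G -> y \in G -> ~~ cyclic G ->
  slice y G \proper G.
Proof.
move=> pG peG Gy ncG; rewrite properEneq slice_sub // andbT.
apply: contra ncG => /eqP defG; apply/cyclicP; exists y; apply/esym/Phi_nongen.
rewrite (Phi_joing pG) joingC.
have sG'M : G^`(1) \subset 'Mho^1(G).
  by rewrite derg1 (subset_trans peG) // Mho_leq ?eps_gt0.
by rewrite (joing_idPr sG'M) -joing_idl -[RHS]defG.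
Qed.

(** Commutators lie in 'Mho^1(G), hence are central modulo its own 'Mho^1 by
    powerfully_embedded_Mho1; the group is of class 2 there, and collection
    applies. *)
Lemma expgM_mod_Mho2 G : p.-group G -> powerfully_embedded p G G ->
  let K := 'Mho^1('Mho^1(G)) in
  {in G &, forall a b, coset K (a * b) ^+ p = coset K a ^+ p * coset K b ^+ p}.
Proof.
move=> pG peG; set M := 'Mho^1(G)%G; move=> K a b Ga Gb.
have peM : powerfully_embedded p M G by apply: powerfully_embedded_Mho1.
have nKG : G \subset 'N(K) by rewrite !gFnorm_trans ?normG.
have pM : p.-group M by apply: pgroup_Mho.
have Nx x : x \in G -> x \in 'N(K) by apply: (subsetP nKG).
have Md : [~ b, a] \in 'Mho^(eps p)(G) by rewrite (subsetP peG) ?mem_commg.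
have MMd : [~ b, a] \in M by rewrite (subsetP (Mho_leq _ (eps_gt0 p))).
have cd h : h \in G -> commute (coset K h) [~ coset K b, coset K a].
  move=> Gh; rewrite -morphR ?Nx //; apply: commute_sym; apply/commgP.
  rewrite -morphR ?Nx ?groupR //=; apply/eqP/coset_id.
  apply: (subsetP (Mho_leq M (eps_gt0 p))); apply: (subsetP peM).
  exact: mem_commg.
rewrite morphM ?Nx // (expgM_p p_pr (cd _ _) (cd _ _)) //.
rewrite -morphR ?Nx // -morphX ?Nx ?groupR //=; apply: coset_id.
move: Md; rewrite /eps; case: eqP => [p2 | _] Md.
  rewrite expg1; apply: subsetP Md.
  by rewrite (subset_trans (MhoD_sub 1 1 pG)).
exact: (Mho_expg pM 1 MMd).
Qed.

(** By expgM_mod_Mho2, x = k g^p with k in 'Mho^1('Mho^1(G)).  Then x already lies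
    in 'Mho^1 of the slice through g, which is a proper subgroup unless G is
    cyclic: induction on |G| applies. *)
Lemma Mho1_expgP G x :
    p.-group G -> powerfully_embedded p G G -> x \in 'Mho^1(G) ->
  exists2 y, y \in G & x = y ^+ p.
Proof.
have [n] := ubnP #|G|; elim: n => // n IHn in G x * => /ltnSE leGn pG peG Mx.
have [/cyclicP[g defG] | ncG] := boolP (cyclic G).
  have pg : p.-elt g by apply: mem_p_elt pG _; rewrite defG cycle_id.
  move: Mx; rewrite defG (Mho_p_cycle _ pg) => /cycleP[k ->].
  by exists (g ^+ k); rewrite ?mem_cycle // expgAC.
pose M := 'Mho^1(G)%G; pose K := 'Mho^1(M)%G.
have nKG : G \subset 'N(K) by rewrite !gFnorm_trans ?normG.
have nKM : M \subset 'N(K) by rewrite (subset_trans (Mho_sub _ _)).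
have pM : p.-group M by apply: pgroup_Mho.
pose S := [set coset K g ^+ p | g in G].
have gS : group_set S.
  apply/group_setP; split=> [|_ _ /imsetP[a Ga ->] /imsetP[b Gb ->]].
    by apply/imsetP; exists 1; rewrite // morph1 expg1n.
  by apply/imsetP; exists (a * b); rewrite ?groupM // expgM_mod_Mho2.
have: coset K x \in Group gS.
  have sMS : M / K \subset Group gS.
    have pGK : p.-group (G / K) by apply: quotient_pgroup.
    rewrite (quotient_Mho 1 nKG); apply: (sub_Mho pGK (A := Group gS)).
    move=> _ /morphimP[g Ng Gg ->]; apply/imsetP; exists g => //.
  by apply: (subsetP sMS); apply: mem_quotient.
case/imsetP=> g Gg; rewrite -morphX ?(subsetP nKG) //.
have [NKx NKg] : x \in 'N(K) /\ g ^+ p \in 'N(K).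
  by rewrite (subsetP nKM) ?(subsetP nKG) ?groupX.
case/(rcoset_kercosetP NKx NKg)/rcosetP=> k Kk xE.
pose H := slice g G.
have pH : p.-group H by rewrite (pgroupS (slice_sub Gg)).
have MHx : x \in 'Mho^1(H).
  rewrite xE groupM //; last by rewrite (Mho_expg pH 1) ?mem_slice.
  by rewrite (subsetP (MhoS 1 (Mho1_sub_slice g G))).
have [||||y Hy ->] := IHn H x => //; first last.
- by exists y; rewrite // (subsetP (slice_sub Gg)).
- exact: powerfully_embedded_slice.
exact: leq_trans (proper_card (slice_proper _ _ _ _)) leGn.
Qed.

Section Chain.

Variable G : {group gT}.
Hypotheses (pG : p.-group G) (peG : powerfully_embedded p G G).

(** The three facts support each other: the roots of level n identify
    'Mho^n.+1(G) with 'Mho^1('Mho^n(G)), which lets powerful embedding and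
    Mho1_expgP be applied one level further. *)
Lemma Mho_chain n :
  [/\ powerfully_embedded p 'Mho^n(G) G,
      forall x, x \in 'Mho^n(G) -> exists2 y, y \in G & x = y ^+ (p ^ n)
    & 'Mho^n.+1(G) = 'Mho^1('Mho^n(G))].
Proof.
have step m : powerfully_embedded p 'Mho^m(G) G ->
    (forall x, x \in 'Mho^m(G) -> exists2 y, y \in G & x = y ^+ (p ^ m)) ->
    'Mho^m.+1(G) = 'Mho^1('Mho^m(G)).
  move=> pem rootm; have pM := pgroup_Mho pG m; apply/eqP.
  rewrite eqEsubset -{1}[m.+1]addn1 (MhoD_sub m 1 pG) /=; apply: (sub_Mho pM) => x.
  by case/rootm=> y Gy ->; rewrite -expgM -expnD addn1 (Mho_expg pG).
elim: n => [|n [pen rootn defMn]].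
  have peG0: powerfully_embedded p 'Mho^0(G) G by rewrite Mho0.
  have root0 x : x \in 'Mho^0(G) -> exists2 y, y \in G & x = y ^+ (p ^ 0).
    by rewrite Mho0; exists x.
  by split=> //; apply: step.
have pen1 : powerfully_embedded p 'Mho^n.+1(G) G.
  by rewrite defMn; apply: powerfully_embedded_Mho1; rewrite ?gFnormal.
have rootn1 x : x \in 'Mho^n.+1(G) -> exists2 y, y \in G & x = y ^+ (p ^ n.+1).
  rewrite defMn => /Mho1_expgP[||z /rootn[y Gy ->] ->]; first exact: pgroup_Mho.
    exact: subset_trans (commgS _ (Mho_sub _ _)) pen.
  by exists y; rewrite // -expgM -expnSr.
by split=> //; apply: step.
Qed.

Lemma Mho_root n x :
  x \in 'Mho^n(G) -> exists2 y, y \in G & x = y ^+ (p ^ n).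
Proof. by case: (Mho_chain n) => _ + _; apply. Qed.

Lemma comm_Mho n x g :
  x \in 'Mho^n(G) -> g \in G -> [~ x, g] \in 'Mho^(n + eps p)(G).
Proof.
move=> Mx Gg; have [pen _ _] := Mho_chain n.
have: [~ x, g] \in 'Mho^(eps p)('Mho^n(G)) by rewrite (subsetP pen) ?mem_commg.
apply: subsetP; apply: (sub_Mho (pgroup_Mho pG n)) => z.
by case/Mho_root=> y Gy ->; rewrite -expgM -expnD (Mho_expg pG).
Qed.

Lemma comm_Mho_eps x y : x \in G -> y \in G -> [~ x, y] \in 'Mho^(eps p)(G).
Proof. by move=> Gx Gy; rewrite (subsetP peG) ?mem_commg. Qed.

Lemma comm_root x y n : x \in G -> y \in 'Mho^n(G) -> [~ x, y] \in 'Mho^(n + eps p)(G).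
Proof. by move=> Gx My; rewrite -groupV invg_comm comm_Mho. Qed.

End Chain.

End Powerful.

(** * Orders of commutators *)

Lemma expg_pow_leq (gT : finGroupType) p (z : gT) a b :
  a <= b -> z ^+ (p ^ a) = 1 -> z ^+ (p ^ b) = 1.
Proof. by move/subnKC <-; rewrite expnD expgM => ->; rewrite expg1n. Qed.

Lemma mem_Ohm (gT : finGroupType) (p : nat) (T : {group gT}) i z :
  p.-group T -> z \in T -> z ^+ (p ^ i) = 1 -> z \in 'Ohm_i(T).
Proof. by move=> pT Tz zi; rewrite (OhmE i pT) mem_gen // inE Tz inE zi eqxx. Qed.

(** The subgroups whose Omega subgroups get bounded: G itself for odd p, but for
    p = 2 only the slices.  These are cyclic over the squares, and any subgroup
    that is cyclic over the squares is contained in one of them. *)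
Definition thin (p : nat) (gT : finGroupType) (G : {group gT}) (t : gT) :
  {group gT} := if p == 2 then slice t G else G.

Definition Omega_bounded (p : nat) (gT : finGroupType) (G : {group gT}) : Prop :=
  forall i t x, t \in G -> x \in 'Ohm_i(thin p G t) -> x ^+ (p ^ i) = 1.

Section CommutatorPowers.

Variables (gT : finGroupType) (p : nat) (G : {group gT}).
Hypotheses (p_pr : prime p) (pG : p.-group G) (peG : powerfully_embedded p G G).

Section SmallerBounded.

Hypothesis IH : forall H : {group gT},
  H \proper G -> powerfully_embedded p H H -> Omega_bounded p H.

Let P := 'Mho^(eps p)(G)%G.
Let pP : p.-group P. Proof. exact: pgroup_Mho. Qed.

(** For p = 2 it is 'Mho^2 that appears because it is contained in a slice of the
    proper powerful subgroup 'Mho^1(G). *)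
Lemma Ohm_Mho_eps_expg l x : x \in 'Ohm_l(P) -> x ^+ (p ^ l) = 1.
Proof.
have [G1 | ntG] := eqsVneq G 1.
  have: 'Ohm_l(P) \subset G by rewrite !gFsub_trans.
  by rewrite G1 => /subsetP s1 /s1/set1P->; rewrite expg1n.
pose M := 'Mho^1(G)%G.
have prM : M \proper G.
  by apply: sub_proper_trans (Phi_proper ntG); rewrite (Phi_joing pG) joing_subr.
have peM : powerfully_embedded p M M.
  apply: subset_trans (commgS _ (proper_sub prM)) _.
  by apply: powerfully_embedded_Mho1.
have sP : P \subset thin p M 1.
  rewrite /P /thin /eps; case: eqP => // _.
  by apply: subset_trans (Mho1_sub_slice _ _); apply: (MhoD_sub 1 1 pG).
by move/(subsetP (OhmS l sP)); apply: IH.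
Qed.

(** As [x, y] = (y^x)^-1 y, it suffices to bound an Omega subgroup that contains y
    and y^x; the subgroup T generated by y and 'Mho^(eps p)(G) contains both,
    since [G, G] <= 'Mho^(eps p)(G), and it is thin in the slice through y. *)
Lemma expg_comm_eq1 i x y :
  x \in G -> y \in G -> y ^+ (p ^ i) = 1 -> [~ x, y] ^+ (p ^ i) = 1.
Proof.
move=> Gx Gy yi.
have [/cyclic_abelian/centsP cG | ncG] := boolP (cyclic G).
  by have /commgP/eqP-> := cG x Gx y Gy; rewrite expg1n.
pose H := slice y G; have prH : H \proper G by apply: (slice_proper pG).
have peH : powerfully_embedded p H H by apply: powerfully_embedded_slice.
pose T := (<[y]> <*> P)%G.
have Ty : y \in T by rewrite (subsetP (joing_subl _ _)) ?cycle_id.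
have sPM : P \subset 'Mho^1(G) by apply/Mho_leq/eps_gt0.
have sT : T \subset thin p H y.
  rewrite /thin /T /P /eps; case: eqP => [p2 | _]; rewrite join_subG cycle_subG.
    rewrite mem_slice; apply: subset_trans (Mho1_sub_slice _ _).
    exact: subset_trans (MhoD_sub 1 1 pG) (MhoS 1 (Mho1_sub_slice y G)).
  by rewrite mem_slice Mho1_sub_slice.
have sTG : T \subset G by rewrite join_subG cycle_subG Gy Mho_sub.
have pT : p.-group T := pgroupS sTG pG.
have Tyx : y ^ x \in T.
  rewrite conjg_mulR groupM // (subsetP (joing_subr _ _)) //.
  exact: (subsetP peG) (mem_commg Gy Gx).
apply: (IH prH peH (t := y)); first exact: mem_slice.
apply: (subsetP (OhmS i sT)); rewrite commgEr conjVg groupM ?groupV //.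
  by apply: (mem_Ohm pT Tyx); rewrite -conjXg yi conj1g.
exact: (mem_Ohm pT).
Qed.

(** The truncated difference i - j - k encodes the convention for negative
    exponents: when it is 0 the commutator itself is trivial.  The proof compares
    x' and x' c modulo N, with x', c, l and N as in the introduction. *)
Lemma expg_comm_expg i x y j k :
    x \in G -> y \in G -> x ^+ (p ^ i.+1) = 1 -> y ^+ (p ^ i) = 1 ->
  [~ x ^+ (p ^ j), y ^+ (p ^ k)] ^+ (p ^ (i - j - k)) = 1.
Proof.
have [e oG] := p_natP pG.
have expG z n : z \in G -> e <= n -> z ^+ (p ^ n) = 1.
  by move=> Gz; move/expg_pow_leq; apply; rewrite -oG expg_cardG.
have [n] := ubnP (3 * e - i); elim: n => // n IHn in i x y j k *.
move=> /ltnSE le_n Gx Gy xi yi.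
(* For i >= 3 e the claim is trivial: either j or k is at least e and a power is
   trivial, or i - j - k >= e.  This starts the downward induction on i. *)
have [le3e | lt3e] := leqP (3 * e) i.
  have [lej | ltj] := leqP e j; first by rewrite expG // comm1g expg1n.
  have [lek | ltk] := leqP e k; first by rewrite (expG y) // commg1 expg1n.
  by apply: expG; rewrite ?groupR ?groupX //; lia.
have{IHn} IHi := IHn i.+1 _ _ _ _ _; have{le_n lt3e} lt_n : 3 * e - i.+1 < n by lia.
elim: j => [|j IHj].
  rewrite subn0 expg1.
  have [lek | ltk] := leqP k i.
    apply: expg_comm_eq1; rewrite ?groupX -?expgM -?expnD ?subnKC //.
  by rewrite (expg_pow_leq (ltnW ltk) yi) commg1 expg1n.
set x' := x ^+ (p ^ j) in IHj *; set y' := y ^+ (p ^ k) in IHj *.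
have Gx' : x' \in G by rewrite groupX.
have Gy' : y' \in G by rewrite groupX.
rewrite expnSr expgM -/x'; set c := [~ x', y'] in IHj.
have [l0 | lt_l] := posnP (i - j - k).
  have /commgP c1 : c == 1 by rewrite -[c]expg1 -IHj l0.
  have -> : [~ x' ^+ p, y'] = 1 by apply/eqP/commgP/commute_sym/commuteX/commute_sym.
  by rewrite expg1n.
have [l def_i] : exists l, i = l.+1 + j + k.
  by exists (i - j.+1 - k); move: lt_l; clear; lia.
have -> : i - j.+1 - k = l by rewrite def_i; clear; lia.
have def_l : i - j - k = l.+1 by rewrite def_i; clear; lia.
rewrite def_l in IHj; clear def_l lt_l.
pose N := 'Ohm_l(P)%G.
have nNG : G \subset 'N(N) by rewrite !gFnorm_trans ?normG.
have Nx z : z \in G -> z \in 'N(N) by apply: (subsetP nNG).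
have sPG : P \subset G by apply: Mho_sub.
have Gc : c \in G by rewrite groupR.
have Pc : c \in P by apply: comm_Mho_eps.
(* The roots of c and of a = [c, x'] below satisfy the order conditions of the
   claim for i.+1. *)
have [z Gz def_c] : exists2 z, z \in G & c = z ^+ (p ^ (k + eps p)).
  by apply: (Mho_root p_pr pG peG); apply: comm_root; rewrite ?(Mho_expg pG).
have zi : z ^+ (p ^ (k + eps p + l.+1)) = 1 by rewrite expnD expgM -def_c.
have e0 := eps_gt0 p; have e2 := eps_le2 p.
set a := [~ c, x']; have Ga : a \in G by rewrite groupR.
have Pa : a \in P by apply: comm_Mho_eps.
have ai : a ^+ (p ^ (l + (2 - eps p))) = 1.
  rewrite /a def_c; have := IHi z x (k + eps p) j lt_n Gz Gx _ xi.
  have -> : i.+1 - (k + eps p) - j = l + (2 - eps p).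
    by rewrite def_i; move: e0 e2; clear; lia.
  by apply; apply: expg_pow_leq zi; rewrite def_i; move: e2; clear; lia.
have [u Gu def_a] : exists2 u, u \in G & a = u ^+ (p ^ (k + 2)).
  apply: (Mho_root p_pr pG peG).
  apply: (subsetP (Mho_leq (n := k + eps p + eps p) _ _)); first by move: e0; clear; lia.
  by apply: comm_Mho => //; rewrite def_c (Mho_expg pG).
have ui : u ^+ (p ^ (k + 2 + l.+1)) = 1.
  by rewrite expnD expgM -def_a; apply: expg_pow_leq ai; move: e0; clear; lia.
(* Used for x and for its conjugate x ^ y', the p^j-th power of which is x' c. *)
have Na x0 : x0 \in G -> x0 ^+ (p ^ i.+1) = 1 -> [~ a, x0 ^+ (p ^ j)] \in N.
  move=> Gx0 x0i; apply: (mem_Ohm pP); first by apply: comm_Mho_eps; rewrite ?groupX.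
  rewrite def_a; have := IHi u x0 (k + 2) j lt_n Gu Gx0 _ x0i.
  have -> : i.+1 - (k + 2) - j = l by rewrite def_i; clear; lia.
  by apply; apply: expg_pow_leq ui; rewrite def_i; clear; lia.
have cosN z1 z2 : z1 \in G -> z2 \in G -> [~ z1, z2] \in N ->
    commute (coset N z2) (coset N z1).
  move=> G1 G2 N12; apply/commute_sym/commgP.
  by rewrite -morphR ?Nx //= coset_id.
have cX : commute (coset N x') (coset N a) by apply: cosN; rewrite ?Na.
have cXC : commute (coset N (x' * c)) (coset N a).
  apply: cosN => //; first exact: groupM.
  have -> : x' * c = (x ^ y') ^+ (p ^ j) by rewrite -conjXg conjg_mulR.
  by apply: Na; rewrite ?groupJ // -conjXg xi conj1g.
have cC : commute (coset N c) (coset N a).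
  have -> : coset N c = (coset N x')^-1 * coset N (x' * c).
    by rewrite [coset N (x' * c)]morphM ?Nx //= mulKg.
  apply: commute_sym; apply: commuteM; apply: commute_sym; last exact: cXC.
  by apply: commute_sym; apply: commuteV; apply: commute_sym.
have defA : coset N a = [~ coset N c, coset N x'] by rewrite -morphR ?Nx.
have pE : coset N (x' * c) ^+ p = coset N x' ^+ p.
  rewrite morphM ?Nx // (expgM_p p_pr) -?defA //.
    rewrite -(morphX _ _ (Nx _ Gc)) /= (coset_id (x := c ^+ p)) ?mulg1 //.
    by apply: (mem_Ohm pP); rewrite ?groupX // -expgM -expnS.
  rewrite -morphX ?Nx //= coset_id //.
  by apply: (mem_Ohm pP); rewrite ?groupX // -expgM -expnD addnC.
apply: Ohm_Mho_eps_expg; apply: coset_idr; first by rewrite Nx // groupR ?groupX.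
rewrite commgEl conjXg conjg_mulR -/c.
have nX z1 z2 : z1 \in G -> z2 \in G ->
    coset N (z1 ^- p * z2 ^+ p) = (coset N z1 ^+ p)^-1 * coset N z2 ^+ p.
  by move=> G1 G2; rewrite morphM ?Nx ?groupV ?groupX //= morphV ?Nx ?groupX //= !morphX ?Nx.
by have := nX _ _ Gx' (groupM Gx' Gc); rewrite pE mulVg.
Qed.

(** * Omega subgroups *)

Lemma involution_comm_Mho1 a b : p = 2 ->
  a \in 'Mho^1(G) -> b \in G -> a ^+ 2 = 1 -> b ^+ 2 = 1 -> commute a b.
Proof.
move=> p2 Ma Gb a2 b2; have [w Gw def_a] := Mho_root p_pr pG peG Ma.
have w4 : w ^+ (p ^ 2) = 1 by rewrite (expnD p 1 1) expgM -def_a p2.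
apply/commgP; have := @expg_comm_expg 1 w b 1 0 Gw Gb w4.
by rewrite p2 -p2 -def_a !expg1 => -> //; rewrite p2.
Qed.

(** Downward induction on m.  Since g^2 = [g, a]^-1 lies in 'Mho^(m + 3), it is the
    square of some q in 'Mho^m.+2, and q commutes with g by expg_comm_expg.  So
    w = g q^-1 is an involution of 'Mho^1; it commutes with a, so that a inverts q
    as well, and q lies one step deeper than g. *)
Lemma inverted_sqr_eq1 m a g : p = 2 -> a \in G -> a ^+ 2 = 1 ->
  g \in 'Mho^m.+1(G) -> g ^ a = g^-1 -> g ^+ 2 = 1.
Proof.
move=> p2 Ga a2; have [e oG] := p_natP pG.
have [n] := ubnP (e - m); elim: n => // n IHn in m g *.
move=> /ltnSE le_n Mg ga; have Gg : g \in G by apply: (subsetP (Mho_sub _ _)) Mg.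
have [v Gv def_g] := Mho_root p_pr pG peG Mg.
have [lem | ltm] := leqP e m.
  rewrite def_g (expg_pow_leq (a := e)) ?expg1n ?leqW //.
  by rewrite -oG expg_cardG.
have g4 : g ^+ 4 = 1.
  have: [~ g, a] ^+ (p ^ 1) = 1 by apply: expg_comm_eq1; rewrite // p2.
  rewrite commgEl ga p2 -[_ * _]/(g^-1 ^+ 2) -expgM expgVn.
  by move/eqP; rewrite eq_invg1 => /eqP.
have Mg2 : g ^+ 2 \in 'Mho^(m + 3)(G).
  have: [~ g, a] \in 'Mho^(m.+1 + eps p)(G) by apply: comm_Mho.
  by rewrite commgEl ga -[_ * _]/(g^-1 ^+ 2) expgVn groupV /eps p2 addSnnS.
have [f Gf def_g2] := Mho_root p_pr pG peG Mg2.
pose q := f ^+ (p ^ (m + 2)).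
have Mq : q \in 'Mho^m.+2(G) by rewrite -addn2 (Mho_expg pG).
have q2 : q ^+ 2 = g ^+ 2 by rewrite def_g2 /q (addnS m 2) expnSr expgM p2.
have cqg : commute q g.
  apply/commgP; have := @expg_comm_expg (m + 3) f v (m + 2) m.+1 Gf Gv.
  rewrite -/q -def_g (_ : _ - _ - _ = 0); last by clear; lia.
  rewrite expg1 => -> //; first by rewrite expnSr expgM -def_g2 p2 -expgM.
  by rewrite -(addSnnS m 2) expnD expgM -def_g p2.
pose w := g * q^-1.
have cgq : commute g q^-1 by apply: commuteV; apply: commute_sym.
have w2 : w ^+ 2 = 1 by rewrite expgMn // expgVn q2 mulgV.
have Mw : w \in 'Mho^1(G).
  apply: (subsetP (Mho_leq (n := m.+1) _ _)) => //; rewrite groupM ?groupV //.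
  by apply: subsetP Mq; apply: Mho_leq.
have wa : w ^ a = w.
  by apply/conjg_fixP/commgP; apply: involution_comm_Mho1.
have def_q : q = w^-1 * g by rewrite /w invMg invgK mulgKV.
rewrite -q2; apply: (IHn m.+1) => //; first by move: le_n ltm; clear; lia.
have Vw : w^-1 = w by apply/eqP; rewrite eq_invg_mul -[w * w]/(w ^+ 2) w2.
rewrite {1}def_q conjMg conjVg wa ga Vw.
by rewrite /w cgq mulgK.
Qed.

(** For p = 2 and involutions a, b: if one of them lies in M = 'Mho^1(G), they
    commute.  Otherwise both are congruent to t modulo M, so that a b lies in M;
    as it is inverted by a, inverted_sqr_eq1 applies. *)
Lemma Ohm1_thin_expg t : t \in G -> {in 'Ohm_1(thin p G t), forall x, x ^+ p = 1}.
Proof.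
move=> Gt; set T := thin p G t.
have sTG : T \subset G by rewrite /T /thin; case: ifP => // _; apply: slice_sub.
suffices mulT a b : a \in T -> b \in T -> a ^+ p = 1 -> b ^+ p = 1 ->
    (a * b) ^+ p = 1.
  have gS : group_set 'Ldiv_p(T).
    apply/group_setP; split=> [|a b]; first by rewrite !inE group1 expg1n /=.
    rewrite !inE => /andP[Ta /eqP ap] /andP[Tb /eqP bp].
    by rewrite groupM // mulT //=.
  move=> x; rewrite (OhmE 1 (pgroupS sTG pG)) -[(p ^ 1)%N]/p (gen_set_id gS).
  by rewrite !inE => /andP[_ /eqP].
move=> Ta Tb ap bp; have Ga := subsetP sTG a Ta; have Gb := subsetP sTG b Tb.
have [p2 | p_neq2] := eqVneq p 2.
  pose M := 'Mho^1(G)%G; have nMG : G \subset 'N(M) by rewrite gFnorm.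
  rewrite p2 in ap bp *.
  have [Ma | nMa] := boolP (a \in M).
    by rewrite expgMn ?ap ?bp ?mulg1 //; apply: involution_comm_Mho1.
  have [Mb | nMb] := boolP (b \in M).
    rewrite expgMn ?ap ?bp ?mulg1 //; apply: commute_sym.
    exact: involution_comm_Mho1.
  have Nt := subsetP nMG _ Gt.
  have t2 : coset M t ^+ 2 = 1.
    rewrite -morphX //= coset_id // -[2]/(2 ^ 1)%N -p2.
    exact: (Mho_expg pG).
  have cosT z : z \in T -> z \notin M -> coset M z = coset M t.
    move=> Tz nMz; have Nz := subsetP nMG _ (subsetP sTG _ Tz).
    have: coset M z \in <[coset M t]>.
      rewrite -(quotient_cycle Nt) -quotientYidr ?cycle_subG //.
      by apply: mem_quotient; move: Tz; rewrite /T /thin p2.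
    case/cycleP=> k zk; rewrite zk -(odd_double_half k) expgD -mul2n expgM t2.
    rewrite expg1n mulg1; case k_odd: (odd k) => //; case/negP: nMz.
    apply: (coset_idr Nz); rewrite zk -(odd_double_half k) k_odd add0n -mul2n.
    by rewrite expgM t2 expg1n.
  have Nab : a * b \in 'N(M) by rewrite (subsetP nMG) ?groupM.
  have Mab : a * b \in M.
    apply: (coset_idr Nab); rewrite morphM ?(subsetP nMG) //=.
    by rewrite !cosT // -[_ * _]/(coset M t ^+ 2) t2.
  apply: (inverted_sqr_eq1 (m := 0) (a := a)) => //.
  have [Va Vb] : a^-1 = a /\ b^-1 = b.
    by split; apply/eqP; rewrite eq_invg_mul -[_ * _]/(_ ^+ 2) ?ap ?bp.
  by rewrite invMg Va Vb conjgE Va !mulgA -[a * a]/(a ^+ 2) ap mul1g.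
have p1 : eps p = 1%N by rewrite /eps (negPf p_neq2).
have Mc : [~ b, a] \in 'Mho^1(G) by rewrite -p1; apply: comm_Mho_eps.
have [w Gw def_c] := Mho_root p_pr pG peG Mc.
have w2 : w ^+ (p ^ 2) = 1.
  by rewrite (expnD p 1 1) expgM -def_c; apply: expg_comm_eq1.
have cc g : g \in G -> g ^+ p = 1 -> commute g [~ b, a].
  move=> Gg gp; apply: commute_sym; apply/commgP.
  have := @expg_comm_expg 1 w g 1 0 Gw Gg w2 gp.
  by rewrite -def_c !expg1 => ->.
rewrite (expgM_p p_pr) ?ap ?bp ?mulg1 ?p1 //; try exact: cc.
exact: (@expg_comm_eq1 1 _ _ Gb Ga ap).
Qed.

End SmallerBounded.

End CommutatorPowers.

Section Induction.

Variable p : nat.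
Hypothesis p_pr : prime p.

Lemma thin_normal (gT : finGroupType) (G : {group gT}) t :
  powerfully_embedded p G G -> t \in G -> thin p G t <| G.
Proof.
move=> peG Gt; rewrite /thin; case: ifP => // _.
rewrite sub_der1_normal ?slice_sub // derg1.
apply: subset_trans (Mho1_sub_slice t G).
by apply: subset_trans peG _; apply/Mho_leq/eps_gt0.
Qed.

Lemma quotient_thin (gT : finGroupType) (G N : {group gT}) t :
  G \subset 'N(N) -> t \in G ->
  thin p G t / N = thin p (G / N)%G (coset N t).
Proof.
move=> nNG Gt; rewrite /thin; case: ifP => // _.
have Nt := subsetP nNG _ Gt.
have nNM : 'Mho^1(G) \subset 'N(N) := subset_trans (Mho_sub _ _) nNG.
by rewrite /= quotientY ?cycle_subG // quotient_cycle // quotient_Mho.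
Qed.

(** 'Ohm_1(T) has exponent p, and factoring it out sends 'Ohm_i.+1(T) into the
    'Ohm_i of a thin subgroup of a smaller powerful group. *)
Lemma powerful_Omega_bounded (gT : finGroupType) (G : {group gT}) :
  p.-group G -> powerfully_embedded p G G -> Omega_bounded p G.
Proof.
have [n] := ubnP #|G|; elim: n => // n IHn in gT G *.
move=> /ltnSE leGn pG peG.
have IH (H : {group gT}) : H \proper G -> powerfully_embedded p H H -> Omega_bounded p H.
  move=> prH; apply: IHn; last exact: pgroupS (proper_sub prH) pG.
  exact: leq_trans (proper_card prH) leGn.
move=> i t x Gt; set T := thin p G t.
have nTG : T <| G by apply: thin_normal.
have sTG := normal_sub nTG; have pT : p.-group T := pgroupS sTG pG.
case: i => [|i]; first by rewrite Ohm0 => /set1P->; rewrite expg1n.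
pose N := 'Ohm_1(T)%G.
have [T1 | ntT] := eqsVneq T 1.
  by rewrite T1 Ohm1 => /set1P->; rewrite expg1n.
have nNG : G \subset 'N(N) by rewrite normal_norm // gFnormal_trans.
have expN z : z \in N -> z ^+ p = 1 by apply: Ohm1_thin_expg.
have Nx z : z \in T -> z \in 'N(N) by move/(subsetP sTG)/(subsetP nNG).
have boundQ : Omega_bounded p (G / N)%G.
  apply: IHn; [|exact: quotient_pgroup | exact: quotient_powerfully_embedded].
  apply: leq_trans leGn; rewrite ltn_quotient //; first by rewrite Ohm1_eq1.
  exact: subset_trans (Ohm_sub _ _) sTG.
have pTN : p.-group (T / N) by apply: quotient_pgroup.
have sQ : 'Ohm_i.+1(T) / N \subset 'Ohm_i(T / N).
  rewrite (OhmE _ pT) quotient_gen; last first.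
    by apply/subsetP=> z /setIP[Tz _]; apply: Nx.
  rewrite gen_subG; apply/subsetP=> _ /morphimP[z Nz /setIP[Tz] + ->].
  rewrite inE => /eqP z1; apply: (mem_Ohm pTN); first exact: mem_quotient.
  rewrite -morphX //= coset_id //; apply: (mem_Ohm pT); first exact: groupX.
  by rewrite -expgM -expnSr.
move=> Ox; have Tx : x \in T by apply: (subsetP (Ohm_sub _ _)) Ox.
have Qx : coset N x ^+ (p ^ i) = 1.
  apply: (boundQ i (coset N t)); first by apply: mem_quotient.
  by rewrite -quotient_thin // (subsetP sQ) // mem_quotient.
rewrite expnSr expgM expN //; apply: coset_idr; first by rewrite groupX ?Nx.
by rewrite morphX ?Nx.
Qed.

End Induction.

Lemma exponent_le_pexp (p : nat) (gT : finGroupType) (A : {set gT}) i :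
  prime p -> {in A, forall x, x ^+ (p ^ i) = 1} -> exponent A <= p ^ i.
Proof.
by move=> p_pr /exponentP; apply: dvdn_leq; rewrite expn_gt0 prime_gt0.
Qed.

Lemma order_leP (p : nat) (gT : finGroupType) (G : {group gT}) x i :
  prime p -> p.-group G -> x \in G -> reflect (x ^+ (p ^ i) = 1) (#[x] <= p ^ i).
Proof.
move=> p_pr pG Gx; have [k ok] := p_natP (mem_p_elt pG Gx).
rewrite ok leq_exp2l ?prime_gt1 // -(dvdn_Pexp2l _ _ (prime_gt1 p_pr)) -ok.
by rewrite order_dvdn; apply: eqP.
Qed.

Lemma cyclic_over_squares_slice (gT : finGroupType) (G T : {group gT}) :
  2.-group G -> T \subset G -> cyclic_over_squares G T ->
  exists2 t, t \in G & T \subset slice t G.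
Proof.
move=> pG sTG /(cyclic_over_squaresP sTG)[t Tt sT].
exists t; first exact: (subsetP sTG).
rewrite (subset_trans sT) // gen_subG subUset sub1set mem_slice /=.
by rewrite /power_subgroup -(MhoE 1 pG) Mho1_sub_slice.
Qed.

Theorem theorem1 (p : nat) (gT : finGroupType) (G : {group gT})
    (p_prime : prime p) (pG : p.-group G) (powG : powerful p G) (i : nat) :
  [/\ (forall x y : gT, x \in G -> y \in G ->
         #[y] <= p ^ i -> #[[~ x, y]] <= p ^ i),
      (forall x y : gT, x \in G -> y \in G ->
         #[x] <= p ^ i.+1 -> #[y] <= p ^ i ->
         forall j k : nat,
           order_le p [~ x ^+ (p ^ j)%N, y ^+ (p ^ k)%N]
             (Posz i - Posz j - Posz k)%R),
      (odd p -> exponent 'Ohm_i(G) <= p ^ i)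
    & (p = 2 ->
         (forall T : {group gT}, T \subset G -> cyclic_over_squares G T ->
            exponent 'Ohm_i(T) <= 2 ^ i)
         /\ exponent 'Ohm_i(power_subgroup G 2) <= 2 ^ i)].
Proof.
have peG := powerful_embedded_self pG powG.
have bG := powerful_Omega_bounded p_prime pG peG.
have IH (H : {group gT}) : H \proper G -> powerfully_embedded p H H -> Omega_bounded p H.
  by move=> /proper_sub sHG; exact: (powerful_Omega_bounded p_prime (pgroupS sHG pG)).
split.
- move=> x y Gx Gy /(order_leP _ p_prime pG Gy) yi.
  apply/(order_leP _ p_prime pG); first exact: groupR.
  exact: (expg_comm_eq1 p_prime pG peG IH).
- move=> x y Gx Gy /(order_leP _ p_prime pG Gx) xi /(order_leP _ p_prime pG Gy) yi.
  move=> j k; have := expg_comm_expg p_prime pG peG IH j k Gx Gy xi yi.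
  set z := [~ _, _] => z1; have Gz : z \in G by rewrite groupR ?groupX.
  have [lejk | ltjk] := leqP (j + k) i.
    have -> : (Posz i - Posz j - Posz k)%R = Posz (i - j - k) by lia.
    exact/(order_leP _ p_prime pG Gz).
  have [m ->] : exists m, (Posz i - Posz j - Posz k)%R = Negz m.
    by exists (j + k - i).-1; lia.
  by move: z1; have -> : i - j - k = 0 by lia.
- move=> odd_p; apply: exponent_le_pexp => // x Ox; apply: (bG i 1) => //.
  by rewrite /thin; case: eqP odd_p => // ->.
move=> p2; rewrite p2 in pG bG.
have bT (T : {group gT}) : T \subset G -> cyclic_over_squares G T ->
    exponent 'Ohm_i(T) <= 2 ^ i.
  move=> sTG /(cyclic_over_squares_slice pG sTG)[t Gt sTt].
  apply: exponent_le_pexp => // x Ox; apply: (bG i t) => //.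
  exact: subsetP (OhmS i sTt) _ Ox.
split=> //; apply: (bT (power_subgroup_group G 2)); first exact: power_subgroup_sub.
by rewrite /cyclic_over_squares quotientMidr trivg_quotient cyclic1.
Qed.
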